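(* Let $b\ge 2$ be an integer such that both $b$ and $b-4$ are squarefree, let $D:=b^2-4b$, and let $p\ge 3$ be a prime. Let $\mathcal{G}_{p,b}(x):=x^{2p}+bx^p+b$, let $\delta:=\left(\frac{D}{p}\right)$ be the Legendre symbol, and let $V_p$ be the $p$-th term of the sequence defined by $V_0=2$, $V_1=-b$, $V_n=-bV_{n-1}-bV_{n-2}$ for $n\ge 2$. Then: \begin{enumerate} \item If $\delta=0$, then $\mathcal{G}_{p,b}(x)$ is monogenic. \item If $\delta=1$, then $\mathcal{G}_{p,b}(x)$ is not monogenic if and only if \[(2V_p+b^p+b)^2-D(b^{p-1}-1)^2\equiv 0 \pmod{p^3}.\] \item If $\delta=-1$, then $\mathcal{G}_{p,b}(x)$ is not monogenic if and only if \[V_p\equiv -b \pmod{p^2}\quad\text{and}\quad b^{p-1}\equiv 1 \pmod{p^2}.\] \end{enumerate}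
   Context: A monic polynomial $f(x)\in\mathbb{Z}[x]$ of degree $N\ge 2$ is called monogenic if $f(x)$ is irreducible over $\mathbb{Q}$ and $\{1,\theta,\theta^2,\ldots,\theta^{N-1}\}$ is a basis (over $\mathbb{Z}$) for the ring of integers of $\mathbb{Q}(\theta)$, where $f(\theta)=0$. An integer (possibly negative) is squarefree if it is not divisible by $m^2$ for any integer $m>1$; in particular $0$ is not squarefree. The Legendre symbol $\left(\frac{D}{p}\right)$ equals $0$ if $p\mid D$, $1$ if $D$ is a nonzero square modulo $p$, and $-1$ otherwise. *)

(* Defs.v *)
From HB Require Import structures.
From mathcomp Require Import all_boot all_order all_algebra all_field.

Set Implicit Arguments.
Unset Strict Implicit.
Unset Printing Implicit Defensive.

Import GRing.Theory Num.Theory.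
Local Open Scope ring_scope.

(* Membership in the subfield Q(t) of algC. *)
Definition in_Qadjoin (t x : algC) : Prop :=
  exists u v : {poly rat},
    (map_poly ratr v).[t] != 0
    /\ x = (map_poly ratr u).[t] / (map_poly ratr v).[t].

Definition in_ring_of_integers (t x : algC) : Prop :=
  in_Qadjoin t x /\ x \in Aint.

Definition is_Zbasis (n : nat) (S : algC -> Prop) (e : 'I_n -> algC) : Prop :=
  (forall x, S x <->
     exists c : {ffun 'I_n -> int}, x = \sum_(i < n) (c i)%:~R * e i)
  /\ (forall c : {ffun 'I_n -> int},
        \sum_(i < n) (c i)%:~R * e i = 0 -> forall i, c i = 0).

(* The degree of f is (size f).-1, so 2 < size f means degree at least 2.
   Every root of f generates a copy of the same field when f is irreducible,
   and algC contains a root, so quantifying over all roots is harmless. *)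
Definition monogenic (f : {poly int}) : Prop :=
  [/\ f \is monic,
      (2 < size f)%N,
      irreducible_poly (map_poly (intr : int -> rat) f)
    & forall t : algC, root (map_poly intr f) t ->
        is_Zbasis (in_ring_of_integers t)
                  (fun i : 'I_(size f).-1 => t ^+ i)].

Definition squarefreez (n : int) : Prop :=
  forall m : int, 1 < m -> ~~ (m ^+ 2 %| n)%Z.

Definition legendre (a : int) (p : nat) : int :=
  if (p%:Z %| a)%Z then 0
  else if [exists x : 'I_p, ((x%:Z) ^+ 2 == a %[mod p%:Z])%Z] then 1
  else -1.

Fixpoint V (b : int) (n : nat) : int :=
  match n with
  | 0%N => 2
  | 1%N => - b
  | (k.+1 as m).+1 => - b * V b m - b * V b k
  end.

Definition G (p : nat) (b : int) : {poly int} :=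
  'X^(2 * p) + b *: 'X^p + b%:P.

(* Main.v *)
(* Since f = x^(2p) + b x^p + b is Eisenstein at the primes dividing b, it is
   irreducible, and Z[t] is the ring of integers iff it is maximal at every
   prime q.  Dedekind's criterion settles each q: write f = h^e + q F with h
   squarefree mod q; maximality amounts to F and h being coprime mod q.
   - q | b: h = x;  q | b - 4, q <> p: h = x^p + 2;  q = p | b - 4: h = x + 2;
     the squarefreeness of b and b - 4 gives coprimality.
   - q not dividing p b (b - 4): f itself is squarefree mod q.
   - q = p not dividing D: h = x^2 + b x + b and e = p.  As h divides
     x^(2p) - V_p x^p + b^p, one finds F = v x^p - b c = (v x - b c)^p mod (p, h),
     where p v = V_p + b and p c = b^(p-1) - 1.  Eliminating x, h and F have a
     common factor iff p divides Q = (2v + bc)^2 - D c^2.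
   Finally p^2 Q = (2 V_p + b^p + b)^2 - D (b^(p-1) - 1)^2, and if D is not a
   square mod p then p | Q forces p | v and p | c. *)
Require Import Defs.
From HB Require Import structures.
From mathcomp Require Import all_boot all_order all_algebra all_field.
From mathcomp Require Import ring zify.

Set Implicit Arguments.
Unset Strict Implicit.
Unset Printing Implicit Defensive.

Import GRing.Theory Num.Theory.
Local Open Scope ring_scope.

(** * Evaluation of integer polynomials at an algebraic number *)

Definition ev (t : algC) (P : {poly int}) : algC := (map_poly intr P).[t].

Lemma ev_zmod_morphism t : zmod_morphism (ev t).
Proof. by move=> P Q; rewrite /ev rmorphB hornerD hornerN. Qed.

Lemma ev_monoid_morphism t : monoid_morphism (ev t).
Proof.
by split=> [|P Q]; rewrite /ev ?rmorph1 ?hornerC // rmorphM hornerM.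
Qed.

HB.instance Definition _ t :=
  GRing.isZmodMorphism.Build {poly int} algC (ev t) (ev_zmod_morphism t).
HB.instance Definition _ t :=
  GRing.isMonoidMorphism.Build {poly int} algC (ev t) (ev_monoid_morphism t).

Lemma evC t (c : int) : ev t c%:P = c%:~R.
Proof. by rewrite /ev map_polyC hornerC. Qed.

Lemma ev_wide t n (P : {poly int}) :
  (size P <= n)%N -> ev t P = \sum_(i < n) (P`_i)%:~R * t ^+ i.
Proof.
move=> le_n; rewrite /ev (@horner_coef_wide _ n) ?size_map_inj_poly //; last exact: intr_inj.
by apply: eq_bigr => i _; rewrite coef_map.
Qed.

Lemma ev_Aint t P : t \in Aint -> ev t P \in Aint.
Proof.
move=> tA; rewrite (ev_wide _ (leqnn _)); apply: rpred_sum => i _.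
by rewrite rpredM ?rpredX // Aint_int.
Qed.

Lemma root_monic_ev_Aint (P : {poly int}) t : P \is monic -> ev t P = 0 -> t \in Aint.
Proof.
move=> mP Pt; apply: (@root_monic_Aint (map_poly intr P)).
- by rewrite /root -/(ev t P) Pt.
- exact: monic_map.
- by apply/polyOverP=> i; rewrite coef_map /=.
Qed.

Lemma Aint_monic_ev x : x \in Aint -> exists2 P : {poly int}, P \is monic & ev x P = 0.
Proof.
have [q [Dq mq] root_q] := minCpolyP x.
rewrite unfold_in => /floorpP[P DP]; exists P.
  rewrite monicE -(eqr_int algC) -(lead_coef_map_inj (f := intr)) //; last exact: intr_inj.
  by rewrite -DP Dq -monicE map_monic.
by apply/eqP; rewrite /ev -DP -/(root _ _) Dq root_q dvdpp.
Qed.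

(** If f did not divide P over Q, irreducibility would give a Bezout relation, which reads 0 = 1 at
    t. Since f is monic, the quotient then has integer coefficients. *)
Lemma dvd_of_ev0 (f P : {poly int}) t :
    f \is monic -> irreducible_poly (map_poly (intr : int -> rat) f) ->
  ev t f = 0 -> ev t P = 0 -> exists S, P = S * f.
Proof.
move=> mf irr ft Pt; apply/(Pdiv.IdomainMonic.dvdpP mf).
rewrite -dvdp_rat_int; apply: contraT => ndv.
have := irreducible_poly_coprime (map_poly intr P) irr; rewrite ndv.
have evQ (R : {poly int}) : ev t R = (map_poly ratr (map_poly (intr : int -> rat) R)).[t].
  by rewrite /ev -map_poly_comp; congr _.[_]; apply: eq_map_poly => c /=; rewrite ratr_int.
move/Bezout_eq1_coprimepP => [[u v] /=].
move=> /(congr1 (fun w => (map_poly (ratr : rat -> algC) w).[t])).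
rewrite rmorphD !rmorphM hornerD !hornerM -!evQ ft Pt !mulr0 addr0.
by rewrite rmorph1 hornerC => /esym/eqP; rewrite oner_eq0.
Qed.

(** * Reduction modulo a prime *)

Local Notation red q := (map_poly (intr : int -> 'F_q)).

Lemma intrFp_eq0 q (x : int) : prime q -> (x%:~R == 0 :> 'F_q) = (q%:Z %| x)%Z.
Proof. by move=> q_pr; rewrite (dvdz_pcharf (pchar_Fp q_pr)). Qed.

Lemma red_eq0 q (P : {poly int}) :
  prime q -> red q P = 0 -> exists R, P = (q%:Z)%:P * R.
Proof.
move=> q_pr redP0; exists (\poly_(i < size P) (P`_i %/ q%:Z)%Z).
apply/polyP=> i; rewrite coefCM coef_poly; case: ltnP => [_|le_i]; last first.
  by rewrite mulr0 nth_default.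
rewrite mulrC divzK // -intrFp_eq0 //.
by have /polyP/(_ i) := redP0; rewrite coef_map coef0 => /eqP.
Qed.

Lemma red_eq q (P Q : {poly int}) :
  prime q -> red q P = red q Q -> exists R, P = Q + (q%:Z)%:P * R.
Proof.
move=> q_pr eqPQ; have [|R DR] := @red_eq0 q (P - Q) q_pr.
  by rewrite rmorphB /= eqPQ subrr.
by exists R; rewrite -DR addrC subrK.
Qed.

Lemma intrFp_surj q (x : 'F_q) : exists y : int, y%:~R = x.
Proof. by exists (nat_of_ord x)%:Z; rewrite -pmulrn natr_Zp. Qed.

Lemma red_surj q (P : {poly 'F_q}) : exists R, red q R = P.
Proof.
elim/poly_ind: P => [|P c [R DR]]; first by exists 0; rewrite rmorph0.
have [d Dd] := intrFp_surj c.
by exists (R * 'X + d%:P); rewrite rmorphD rmorphM /= map_polyX map_polyC /= DR Dd.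
Qed.

Lemma red_q0 q : prime q -> red q (q%:Z)%:P = 0.
Proof.
by move=> q_pr; rewrite map_polyC /= (eqP (_ : (q%:Z)%:~R == 0 :> 'F_q)) ?intrFp_eq0.
Qed.

Lemma dvd_red q (P h : {poly int}) :
  prime q -> red q h %| red q P -> exists s w, P = s * h + (q%:Z)%:P * w.
Proof.
move=> q_pr /dvdpP[s0 Ds]; have [s Ds0] := red_surj s0.
have [|w Dw] := @red_eq q P (s * h) q_pr; first by rewrite rmorphM /= Ds0.
by exists s, w.
Qed.

(** Write h = k d with d = gcd(h, g). Separability makes k coprime to d, hence to g, since a common
    factor of k and g divides d. As k also divides g^n, it is a unit. *)
Lemma separable_dvdp_exp (F : fieldType) (h g : {poly F}) n :
  separable_poly h -> h %| g ^+ n -> h %| g.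
Proof.
move=> seph; have h0 := separable_poly_neq0 seph.
set d := gcdp h g; have dh : d %| h by apply: dvdp_gcdl.
have [k Dk] := dvdpP _ _ dh; have cop_kd : coprimep k d.
  by apply: (separable_coprime seph); rewrite Dk.
have kh : k %| h by rewrite Dk dvdp_mulr.
have cop_kg : coprimep k g.
  move: (cop_kd); rewrite !coprimep_def => /eqP <-; apply/eqP/eqp_size.
  rewrite /eqp !dvdp_gcd !dvdp_gcdl dvdp_gcdr /=.
  by rewrite (dvdp_trans (dvdp_gcdl _ _) kh) (dvdp_trans (dvdp_gcdr _ _) (dvdp_gcdr _ _)).
move=> /(dvdp_trans kh); have /coprimepP := coprimep_expr n cop_kg.
move=> /(_ k (dvdpp _)) cop /cop /eqp_dvdl k1.
rewrite Dk Gauss_dvdp // k1 dvd1p; exact: dvdp_gcdr.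
Qed.

(* If [z] is a root of the monic [P], then [q z] is a root of its homogenization
   [sum_i P_i q^(n-i) X^i], which reduces to ['X^n] modulo [q]. *)
Lemma nilpotent_red (f g : {poly int}) t q m z :
    f \is monic -> irreducible_poly (map_poly (intr : int -> rat) f) ->
    ev t f = 0 -> prime q -> z \in Aint -> ev t g ^+ m = q%:R * z ->
  exists n, red q f %| red q g ^+ n.
Proof.
move=> mf irr ft q_pr /Aint_monic_ev[P mP Pz] Dz.
pose n := (size P).-1; exists (m * n)%N.
have sP : size P = n.+1 by rewrite /n prednK // size_poly_gt0 monic_neq0.
pose H := \sum_(i < n.+1) (P`_i * q%:Z ^+ (n - i))%:P * (g ^+ m) ^+ i.
(* At t, g^m takes the value q z, so H(t) = q^n P(z) = 0. *)
have [|S DS] := @dvd_of_ev0 f H t mf irr ft.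
  rewrite rmorph_sum /=; transitivity (q%:R ^+ n * ev z P); last by rewrite Pz mulr0.
  rewrite (ev_wide _ (leqnn _)) sP mulr_sumr; apply: eq_bigr => i _.
  rewrite (rmorphM (ev t)) /= evC !(rmorphXn (ev t)) /= Dz rmorphM rmorphXn /=.
  have -> : q%:R ^+ n = q%:R ^+ (n - i) * q%:R ^+ i :> algC.
    by rewrite -exprD subnK // -ltnS.
  rewrite exprMn -pmulrn; ring.
have <- : red q H = red q g ^+ (m * n).
  rewrite rmorph_sum big_ord_recr /= big1 => [|i _].
    rewrite add0r subnn mulr1 rmorphM /= -rmorphXn -exprM /=.
    have := monicP mP; rewrite lead_coefE sP /= => ->.
    by rewrite map_polyC /= mul1r.
  have q0 : (q%:Z)%:~R = 0 :> 'F_q by apply/eqP; rewrite intrFp_eq0 ?dvdzz.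
  rewrite rmorphM /= map_polyC /= rmorphM /= rmorphXn /= q0.
  by rewrite expr0n subn_eq0 leqNgt ltn_ord mulr0 mul0r.
by rewrite DS rmorphM dvdp_mull.
Qed.

(** * Dedekind's criterion *)

(** For an algebraic integer t this says that q does not divide the index of Z[t] in the integers of
    Q(t), without mentioning an index. *)
Definition q_maximal (t : algC) (q : nat) : Prop :=
  forall (x : algC) (P : {poly int}),
    x \in Aint -> q%:R * x = ev t P -> exists R, x = ev t R.

(** If q x = s(t), then f divides a power of s modulo q, hence s itself by separability; so s = u f
    + q w and x = w(t). *)
Lemma squarefree_q_maximal (f : {poly int}) t q :
    f \is monic -> irreducible_poly (map_poly (intr : int -> rat) f) ->
    ev t f = 0 -> prime q -> separable_poly (red q f) ->
  q_maximal t q.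
Proof.
move=> mf irr ft q_pr sepf x s xA Dx.
have [|n fs] := @nilpotent_red f s t q 1%N x mf irr ft q_pr xA; first by rewrite expr1.
have [u [w Dw]] := dvd_red q_pr (separable_dvdp_exp sepf fs).
exists w; apply: (@mulfI _ q%:R); first by rewrite pnatr_eq0 -lt0n prime_gt0.
by rewrite Dx Dw rmorphD !rmorphM /= ft mulr0 add0r evC pmulrn.
Qed.

Lemma coprime_red_lift q (F h : {poly int}) :
    prime q -> coprimep (red q F) (red q h) ->
  exists A B C, A * F + B * h = 1 + (q%:Z)%:P * C.
Proof.
move=> q_pr /Bezout_eq1_coprimepP[[A0 B0] /= Dbez].
have [A DA] := red_surj A0; have [B DB] := red_surj B0.
have [|C DC] := @red_eq q (A * F + B * h) 1 q_pr.
  by rewrite rmorphD !rmorphM rmorph1 /= DA DB.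
by exists A, B, C.
Qed.

(* If [q x] lies in [h(t)^j Z[t]] up to [q Z[t]] with [j < e], then [F s] is,
   up to sign, [h^(e-j)] times an algebraic integer; its [e]-th power is thus
   divisible by [q], which forces [h] to divide [s] modulo [q]. *)
Lemma dedekind_q_maximal (f h F : {poly int}) e t q :
    f \is monic -> irreducible_poly (map_poly (intr : int -> rat) f) ->
    ev t f = 0 -> prime q -> (0 < e)%N -> f = h ^+ e + (q%:Z)%:P * F ->
    separable_poly (red q h) -> coprimep (red q F) (red q h) ->
  q_maximal t q.
Proof.
move=> mf irr ft q_pr e_gt0 Df seph copF x s0 xA Dx.
have tA : t \in Aint := root_monic_ev_Aint mf ft.
have q_neq0 : q%:R != 0 :> algC by rewrite pnatr_eq0 -lt0n prime_gt0.
have [A [B [C Dbez]]] := coprime_red_lift q_pr copF.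
have hqF : ev t h ^+ e = - (q%:R * ev t F).
  apply/eqP; rewrite -addr_eq0 -ft Df rmorphD rmorphM rmorphXn /= evC.
  by rewrite pmulrn.
have bez : ev t A * ev t F + ev t B * ev t h = 1 + q%:R * ev t C.
  by rewrite -!rmorphM -rmorphD Dbez rmorphD rmorphM rmorph1 /= evC pmulrn.
(* If h(t) = 0 then F(t) = 0 as well, and the Bezout relation makes -C(t) the inverse of q. *)
have [h0|h_neq0] := eqVneq (ev t h) 0.
  have F0 : ev t F = 0.
    move/eqP: hqF; rewrite h0 expr0n eqn0Ngt e_gt0 eq_sym oppr_eq0 mulf_eq0.
    by rewrite (negPf q_neq0) => /eqP.
  exists (- (C * s0)); rewrite rmorphN rmorphM /= -Dx.
  move: bez; rewrite F0 h0 !mulr0 addr0 => /eqP; rewrite eq_sym addr_eq0 => /eqP one.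
  by rewrite -[LHS]mul1r {1}one; ring.
have step j : (j <= e)%N ->
    exists r s, q%:R * (x - ev t r) = ev t h ^+ j * ev t s.
  elim: j => [_ | j IH lt_je]; first by exists 0, s0; rewrite rmorph0 subr0 mul1r.
  have [r [s Dj]] := IH (ltnW lt_je).
  have [x' Dx'] : exists x' : algC, x' = x - ev t r by exists (x - ev t r).
  rewrite -Dx' in Dj.
  have x'A : x' \in Aint by rewrite Dx' rpredB ?ev_Aint.
  (* Multiply q x' = h^j s by F, replace q F by -h^e and cancel h^j, all at t. *)
  have DFs : ev t (F * s) = - (ev t h ^+ (e - j) * x').
    apply: (mulfI (expf_neq0 j h_neq0)).
    rewrite mulrN mulrA -exprD subnKC 1?ltnW // hqF (rmorphM (ev t)) /= mulrCA -Dj; ring.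
  (* Here (h^(e-j))^e = (h^e)^(e-j) = (-q F)^(e-j), and j < e leaves at least one factor q. *)
  have DFse : ev t (F * s) ^+ e =
      q%:R * ((- x') ^+ e * (- ev t F) ^+ (e - j) * q%:R ^+ (e - j).-1).
    rewrite DFs -mulrN exprMn -exprM mulnC exprM hqF.
    have -> : q%:R * ((- x') ^+ e * (- ev t F) ^+ (e - j) * q%:R ^+ (e - j).-1)
      = (- x') ^+ e * (- ev t F) ^+ (e - j) * (q%:R * q%:R ^+ (e - j).-1) by ring.
    by rewrite -exprS prednK ?subn_gt0 // -mulrN exprMn; ring.
  have zA : (- x') ^+ e * (- ev t F) ^+ (e - j) * q%:R ^+ (e - j).-1 \in Aint.
    by rewrite !rpredM ?rpredX ?rpredN ?ev_Aint ?rpred_nat.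
  have [n fFs] := nilpotent_red mf irr ft q_pr zA DFse.
  have hf : red q h %| red q f.
    rewrite Df rmorphD rmorphM /= red_q0 // mul0r addr0 rmorphXn /=.
    by rewrite -(prednK e_gt0) exprS dvdp_mulr.
  have := separable_dvdp_exp seph (dvdp_trans hf fFs).
  rewrite rmorphM /= Gauss_dvdpr 1?coprimep_sym // => hs.
  have [u [w Dw]] := dvd_red q_pr hs.
  exists (r + h ^+ j * w), u.
  rewrite !rmorphD rmorphM rmorphXn /= opprD addrA mulrDr -Dx' Dj Dw.
  by rewrite rmorphD !rmorphM /= evC -pmulrn exprS; ring.
(* For j = e, q (x - r) = h^e s = -q F s, so x = r - F s at t. *)
have [r [s De]] := step e (leqnn e).
exists (r - F * s); rewrite rmorphB rmorphM /=; apply: (mulfI q_neq0).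
by apply/eqP; rewrite -subr_eq0 mulrBr opprB addrCA -mulrBr De hqF; apply/eqP; ring.
Qed.

(** * From maximality at every prime to an integral basis *)

(** Strong induction on the denominator: with n = m q, maximality at q applied to m x lowers it to
    m. *)
Lemma integral_of_q_maximal t (x : algC) n (P : {poly int}) :
    (forall q, prime q -> q_maximal t q) ->
    (0 < n)%N -> x \in Aint -> n%:R * x = ev t P -> exists R, x = ev t R.
Proof.
move=> qmax; elim/ltn_ind: n P => n IH P n_gt0 xA Dx.
have [n_le1|n_gt1] := leqP n 1.
  by exists P; rewrite -Dx (_ : n = 1%N) ?mul1r //; apply/eqP; rewrite eqn_leq n_le1.
have [q q_pr /dvdnP[m Dn]] : exists2 q, prime q & (q %| n)%N.
  by exists (pdiv n); rewrite ?pdiv_prime ?pdiv_dvd.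
have m_gt0 : (0 < m)%N by move: n_gt0; rewrite Dn muln_gt0 => /andP[].
have [||R DR] := qmax q q_pr (m%:R * x) P; first by rewrite rpredM ?rpred_nat.
  by rewrite -Dx Dn natrM mulrA [q%:R * _]mulrC.
by apply: (IH m) DR => //; rewrite Dn ltn_Pmulr ?prime_gt1.
Qed.

(** Since v(t) is nonzero, v is coprime to f, and a Bezout cofactor B of v gives 1/v(t) = B(t); it
    remains to clear the denominators of u B. *)
Lemma Qadjoin_scale (f : {poly int}) t x :
    irreducible_poly (map_poly (intr : int -> rat) f) -> ev t f = 0 ->
    in_Qadjoin t x -> exists n P, (0 < n)%N /\ n%:R * x = ev t P.
Proof.
have evQ (R : {poly int}) : (map_poly ratr (map_poly (intr : int -> rat) R)).[t] = ev t R.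
  by rewrite /ev -map_poly_comp; congr _.[_]; apply: eq_map_poly => c /=; rewrite ratr_int.
move=> irr ft [u [v [vt ->]]].
have ndv : ~~ (map_poly (intr : int -> rat) f %| v).
  apply: contra vt => /dvdpP[w ->].
  by rewrite rmorphM hornerM evQ ft mulr0.
have := irreducible_poly_coprime v irr; rewrite ndv.
move/Bezout_eq1_coprimepP => [[A B] /=].
move=> /(congr1 (fun w => (map_poly (ratr : rat -> algC) w).[t])).
rewrite rmorphD !rmorphM hornerD !hornerM evQ ft mulr0 add0r rmorph1 hornerC => Bv.
have -> : (map_poly ratr u).[t] / (map_poly ratr v).[t] = (map_poly ratr (u * B)).[t].
  apply: (mulIf vt); rewrite mulfVK //.
  by rewrite rmorphM hornerM -mulrA Bv mulr1.
have [Q [a a0 ->]] := rat_poly_scale (u * B).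
exists `|a|%N, ((sgz a)%:P * Q); split; first by rewrite absz_gt0.
rewrite map_polyZ hornerZ evQ rmorphM /= evC fmorphV /= ratr_int mulrA.
congr (_ * _); apply: (mulIf (_ : a%:~R != 0 :> algC)); first by rewrite intr_eq0.
rewrite mulfVK ?intr_eq0 //.
by rewrite -intrM -abszEsg -pmulrn.
Qed.

Definition poly_of_ffun n (c : {ffun 'I_n -> int}) : {poly int} :=
  \poly_(i < n) oapp c 0 (insub i).

Lemma coef_poly_of_ffun n (c : {ffun 'I_n -> int}) (i : 'I_n) :
  (poly_of_ffun c)`_i = c i.
Proof. by rewrite coef_poly ltn_ord valK. Qed.

Lemma ev_poly_of_ffun n (c : {ffun 'I_n -> int}) t :
  ev t (poly_of_ffun c) = \sum_(i < n) (c i)%:~R * t ^+ i.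
Proof.
rewrite (ev_wide _ (size_poly _ _)); apply: eq_bigr => i _.
by rewrite coef_poly_of_ffun.
Qed.

Lemma monic_multiple_small (R : idomainType) (f S : {poly R}) :
  f \is monic -> (size (S * f)%R < size f)%N -> S * f = 0.
Proof.
move=> mf; have [->|S0] := eqVneq S 0; first by rewrite mul0r.
rewrite size_Mmonic // -subn1.
by move: (size_poly_gt0 S); rewrite S0; lia.
Qed.

Lemma monogenic_of_q_maximal (f : {poly int}) :
    f \is monic -> (2 < size f)%N ->
    irreducible_poly (map_poly (intr : int -> rat) f) ->
    (forall t q, ev t f = 0 -> prime q -> q_maximal t q) ->
  monogenic f.
Proof.
move=> mf sf irr qmax; split=> // t /rootP ft; rewrite -/(ev t f) in ft.
have tA := root_monic_ev_Aint mf ft.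
have f_gt0 : (0 < size f)%N by apply: leq_trans sf.
split=> [x|c].
  split=> [[xQ xA]|[c ->]].
    have [n [P [n_gt0 DP]]] := Qadjoin_scale irr ft xQ.
    have [R ->] := integral_of_q_maximal (fun q q_pr => qmax t q ft q_pr) n_gt0 xA DP.
    (* The coordinates of R(t) are the coefficients of the remainder of R modulo f. *)
    exists [ffun i : 'I_(size f).-1 => (Pdiv.Ring.rmodp R f)`_i].
    rewrite [in LHS](Pdiv.RingMonic.rdivp_eq mf R) rmorphD rmorphM /= ft mulr0 add0r.
    rewrite (@ev_wide _ (size f).-1); last first.
      by rewrite -ltnS prednK // Pdiv.Ring.ltn_rmodpN0 ?monic_neq0.
    by apply: eq_bigr => i _; rewrite ffunE.
  rewrite -ev_poly_of_ffun; split; last exact: ev_Aint.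
  exists (map_poly intr (poly_of_ffun c)), 1.
  rewrite rmorph1 hornerC oner_eq0 divr1 -map_poly_comp; split=> //.
  by rewrite /ev; congr _.[_]; apply: eq_map_poly => d /=; rewrite ratr_int.
(* A linear relation is a multiple of f of smaller degree, hence zero. *)
rewrite -ev_poly_of_ffun => /(dvd_of_ev0 mf irr ft)[S DS] i.
rewrite -coef_poly_of_ffun DS monic_multiple_small ?coef0 // -DS.
by rewrite (leq_ltn_trans (size_poly _ _)) // prednK.
Qed.

(** * Obstructions to monogenicity *)

Lemma quadratic_Aint (x c d : algC) :
  c \in Aint -> d \in Aint -> x ^+ 2 + c * x + d = 0 -> x \in Aint.
Proof.
have intA (y : algC) : y \in Aint -> integralOver (intr : int -> algC) y.
  by case/Aint_monic_ev=> P mP /rootP Py; exists P.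
move=> /intA cI /intA dI x0.
suffices [P mP /rootP Px] : integralOver (intr : int -> algC) x.
  exact: (root_monic_ev_Aint mP).
pose p := \poly_(i < 3) [:: d; c; 1]`_i.
apply: (@integral_root_monic _ _ _ _ p).
- by rewrite monicE lead_coefE size_poly_eq ?oner_eq0 // coef_poly.
- apply/rootP; rewrite horner_poly !big_ord_recr big_ord0 /= -[RHS]x0; ring.
apply/integral_poly=> -[|[|[|i]]]; rewrite coef_poly //=.
- exact: integral1.
- exact: integral0.
Qed.

(* With f = q^2 L + q K phi + phi^2 w, the number x = phi(t) w(t) / q is a root
   of x^2 + K(t) x + L(t) w(t), hence integral. *)
Lemma dedekind_not_monogenic (f phi w L K : {poly int}) q :
    prime q -> phi \is monic -> w \is monic -> (1 < size phi)%N ->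
    f = ((q ^ 2)%N%:Z)%:P * L + (q%:Z)%:P * K * phi + phi ^+ 2 * w ->
    (size (phi ^+ 2 * w)%R <= size f)%N ->
  ~ monogenic f.
Proof.
move=> q_pr mphi mw sphi Df le_f [mf sf irr basis].
have [t ft] : exists t, root (map_poly (intr : int -> algC) f) t.
  apply/closed_rootP; rewrite size_map_inj_poly //; last exact: intr_inj.
  by rewrite neq_ltn orbC (ltn_trans _ sf).
have [gen _] := basis t ft; move/rootP: ft; rewrite -/(ev t f) => ft.
have tA := root_monic_ev_Aint mf ft.
have q0 : q%:R != 0 :> algC by rewrite pnatr_eq0 -lt0n prime_gt0.
have [x xE] : exists x : algC, x = ev t (phi * w) / q%:R by exists (ev t (phi * w) / q%:R).
have Dx : q%:R * x = ev t (phi * w) by rewrite xE mulrC divfK.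
have xS : in_ring_of_integers t x.
  split.
    exists (map_poly intr (phi * w)), (q%:R)%:P.
    rewrite map_polyC hornerC /= ratr_nat; split=> //.
    rewrite xE /ev -map_poly_comp; congr (_.[_] / _).
    by apply: eq_map_poly => d /=; rewrite ratr_int.
  apply: (@quadratic_Aint x (ev t K) (ev t (L * w))); rewrite ?ev_Aint //.
  have : ev t f = 0 by [].
  rewrite Df !rmorphD !rmorphM /= !evC -!pmulrn; move=> Ef.
  (* Multiplied by q^2, the quadratic equation for x becomes w(t) f(t) = 0. *)
  apply: (mulfI (expf_neq0 2 q0)).
  transitivity ((q%:R * x) ^+ 2 + q%:R * ev t K * (q%:R * x) + q%:R ^+ 2 * (ev t L * ev t w)).
    by ring.
  rewrite Dx rmorphM /= mulr0 -[RHS](mul0r (ev t w)) -Ef; ring.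
(* If x = R(t) with integer coordinates, then q R - phi w is a multiple of f of smaller degree,
   hence zero, and q divides the leading coefficient 1 of phi w. *)
have [c Dc] := (gen x).1 xS.
rewrite -ev_poly_of_ffun in Dc; set R := poly_of_ffun c in Dc.
have s_lt : (size (phi * w)%R < size f)%N.
  have mpw : phi * w \is monic by rewrite monicMl.
  apply: leq_trans le_f; rewrite expr2 -mulrA [X in (_ < X)%N]size_Mmonic ?monic_neq0 //.
  by rewrite -subn1; move: (size_poly_gt0 (phi * w)); rewrite (monic_neq0 mpw); lia.
have [|S DS] := @dvd_of_ev0 f ((q%:Z)%:P * R - phi * w) t mf irr ft.
  by rewrite rmorphB rmorphM /= evC -pmulrn -Dc Dx subrr.
have s_ltD: (size ((q%:Z)%:P * R - phi * w)%R < size f)%N.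
    rewrite (leq_ltn_trans (size_polyD _ _)) // gtn_max size_polyN s_lt andbT.
    rewrite mul_polyC (leq_ltn_trans (size_scale_leq _ _)) //.
    by rewrite (leq_ltn_trans (size_poly _ _)) // prednK // (leq_trans _ sf).
have Sf0 : S * f = 0 by apply: monic_multiple_small; rewrite // -DS.
move/eqP: DS; rewrite Sf0.
rewrite subr_eq0 => /eqP/(congr1 (fun p : {poly int} => p`_(size (phi * w)%R).-1)).
rewrite coefCM -lead_coefE (monicP (_ : phi * w \is monic)) ?rpredM // => /eqP.
rewrite -(@eqr_int algC).
move=> /eqP Dq; have : (q%:Z %| 1)%Z.
  apply/dvdzP; exists R`_(size (phi * w)%R).-1; rewrite mulrC.
  exact/(intr_inj (R := algC)).
by rewrite dvdz1 /= => /eqP q1; move: q_pr; rewrite q1.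
Qed.


(** The Taylor expansion f = f(a) + f'(a) (X - a) + (X - a)^2 w has the shape required by
    [dedekind_not_monogenic], with phi = X - a. *)
Lemma monogenic_not_at_double_root (f : {poly int}) (a : int) q :
    prime q -> ((q ^ 2)%N%:Z %| f.[a])%Z -> (q%:Z %| f^`().[a])%Z ->
  ~ monogenic f.
Proof.
move=> q_pr /dvdzP[l Dl] /dvdzP[k Dk] mono; have [mf sf _ _] := mono.
set phi := 'X - a%:P : {poly int}; have mphi : phi \is monic by rewrite monicXsubC.
have md : phi ^+ 2 \is monic by rewrite monic_exp.
have sd : size (phi ^+ 2) = 3 by rewrite size_exp_XsubC.
have := Pdiv.RingMonic.rdivp_eq md f.
set w := Pdiv.Ring.rdivp _ _; set r := Pdiv.Ring.rmodp _ _ => Df.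
have sr : (size r <= 2)%N.
  by rewrite -ltnS -[X in (_ < X)%N]sd Pdiv.Ring.ltn_rmodpN0 ?monic_neq0.
have [r1 [r0 Dr]] : exists r1 r0, r = r1%:P * 'X + r0%:P.
  exists r`_1, r`_0; apply/polyP=> -[|[|i]]; rewrite coefD coefMX !coefC /= ?add0r ?addr0 //.
  by rewrite nth_default // (leq_trans sr).
have fa : f.[a] = r1 * a + r0.
  rewrite Df Dr; rewrite /phi !hornerE /= subrr; ring.
have f'a : f^`().[a] = r1.
  rewrite Df Dr /phi !derivE !hornerE /= subrr; ring.
have Dwd : w * phi ^+ 2 = f - r by rewrite {1}Df addrK.
have le_r : (size (- r)%R < size f)%N by rewrite size_polyN (leq_ltn_trans sr).
have mw : w \is monic.
  rewrite -(monicMr _ md) Dwd monicE lead_coefDl //; exact/monicP.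
apply: (@dedekind_not_monogenic f phi w l%:P k%:P q) mono => //.
- by rewrite size_XsubC.
- rewrite -!polyCM [_ * l]mulrC -Dl [_ * k]mulrC -Dk fa f'a {1}Df {1}Dr /phi.
  rewrite !polyCD !polyCM; ring.
- by rewrite mulrC Dwd size_polyDl.
Qed.

(** * The trinomial G *)

Definition hpol (b : int) : {poly int} := 'X^2 + b%:P * 'X + b%:P.

Lemma GE p b : G p b = 'X^p ^+ 2 + b%:P * 'X^p + b%:P.
Proof. by rewrite /G mulnC exprM mul_polyC. Qed.

Lemma size_G p b : (0 < p)%N -> size (G p b) = (2 * p).+1.
Proof.
move=> p_gt0; rewrite /G -addrA size_polyDl size_polyXn //.
rewrite (leq_ltn_trans (size_polyD _ _)) // gtn_max.
rewrite (leq_ltn_trans (size_scale_leq _ _)) ?size_polyXn; last by lia.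
by rewrite (leq_ltn_trans (size_polyC_leq1 _)) //; lia.
Qed.

Lemma monic_G p b : (0 < p)%N -> G p b \is monic.
Proof.
move=> p_gt0; rewrite monicE lead_coefE size_G //= /G !coefD coefZ !coefXn coefC.
rewrite eqxx (_ : (2 * p == p)%N = false); last by apply/eqP; lia.
by rewrite (_ : (2 * p == 0)%N = false) ?mulr0 ?addr0 //; apply/eqP; lia.
Qed.

Lemma squarefreez_prime n q :
  squarefreez n -> prime q -> (q%:Z %| n)%Z ->
  exists2 k, n = q%:Z * k & ~~ (q%:Z %| k)%Z.
Proof.
move=> sqf q_pr /dvdzP[k Dk]; exists k; first by rewrite mulrC.
have := sqf q%:Z; rewrite ltz_nat prime_gt1 // => /(_ isT).
by apply: contra => /dvdzP[l Dl]; rewrite Dk Dl -mulrA -expr2 dvdz_mull.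
Qed.

Lemma irreducible_G p (b : int) :
    (0 < p)%N -> 2 <= b -> squarefreez b ->
  irreducible_poly (map_poly (intr : int -> rat) (G p b)).
Proof.
move=> p_gt0 hb sqf; apply/irreducible_rat_int.
pose q := pdiv `|b|%N; have q_pr : prime q by apply: pdiv_prime; lia.
have qb : (q%:Z %| b)%Z by rewrite dvdzE pdiv_dvd.
have [k Dk qk] := squarefreez_prime sqf q_pr qb.
apply: (eisenstein_crit q_pr).
- by rewrite size_G //; apply/eqP; lia.
- rewrite (monicP (monic_G b p_gt0)) dvdz1 /=.
  by apply: contraL q_pr => /eqP ->.
- rewrite /G !coefD coefZ !coefXn coefC /=.
  rewrite (_ : (0 == 2 * p)%N = false); last by apply/eqP; lia.
  rewrite (_ : (0 == p)%N = false); last by apply/eqP; lia.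
  rewrite mulr0 !add0r; apply: contra qk => qq.
  have : (q%:Z * q%:Z %| q%:Z * k)%Z by rewrite -Dk -expr2.
  by rewrite dvdz_mul2l // eqz_nat -lt0n prime_gt0.
- move=> i; rewrite size_G //= => lt_i; rewrite /G !coefD coefZ !coefXn coefC.
  rewrite (_ : (i == 2 * p)%N = false) ?add0r; last by apply/eqP; lia.
  by rewrite rpredD ?dvdz_mulr //; case: ifP; rewrite ?rpred0.
Qed.

(** Certificate form of coprimality: the combinations supplied below are identities that [ring] can
    check. *)
Lemma coprimep_const (F : fieldType) (u v p q : {poly F}) c :
  c != 0 -> u * p + v * q = c%:P -> coprimep p q.
Proof.
move=> c0 Duv; apply/Bezout_coprimepP; exists (u, v) => /=.
by rewrite Duv -size_poly_eq1 size_polyC c0.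
Qed.

Lemma separable_XsubC (F : fieldType) (a : F) : separable_poly ('X - a%:P).
Proof. by rewrite unlock derivXsubC coprimep1. Qed.

Lemma pnat_pchar_polyFp p : prime p -> [pchar {poly 'F_p}].-nat p.
Proof.
move=> p_pr; rewrite pnatE // inE p_pr /=.
by rewrite -(rmorph_nat (polyC : {rmorphism _ -> _})) pchar_Fp_0.
Qed.

Lemma expFp p (x : 'F_p) : prime p -> x ^+ p = x.
Proof. by move=> p_pr; have := expf_card x; rewrite card_Fp. Qed.

Lemma red_G p b q :
  red q (G p b) = 'X^p ^+ 2 + (b%:~R)%:P * 'X^p + (b%:~R)%:P.
Proof.
by rewrite GE !(rmorphD, rmorphM, rmorphXn) /= !map_polyX !map_polyC.
Qed.

(** * Maximality at every prime, except at p when p does not divide b (b - 4) *)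

Section QMaximal.

Variables (b : int) (p : nat) (t : algC).
Hypotheses (b_ge2 : 2 <= b) (sqf_b : squarefreez b) (p_pr : prime p).
Hypothesis (Gt : ev t (G p b) = 0).

Let p_gt0 : (0 < p)%N := prime_gt0 p_pr.
Let mG := monic_G b p_gt0.
Let irrG := irreducible_G p_gt0 b_ge2 sqf_b.

Lemma q_maximal_dvd_b q : prime q -> (q%:Z %| b)%Z -> q_maximal t q.
Proof.
move=> q_pr qb; have [k Dk qk] := squarefreez_prime sqf_b q_pr qb.
have X0 : 'X = 'X - 0%:P :> {poly 'F_q} by rewrite polyC0 subr0.
(* With b = q k, G = X^(2p) + q k (X^p + 1), and the cofactor takes at 0 the value k, prime to q. *)
apply: (@dedekind_q_maximal (G p b) 'X (k%:P * ('X^p + 1)) (2 * p) t q) => //.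
- by rewrite muln_gt0.
- rewrite GE {1 2}Dk mulnC exprM !polyCM; ring.
- by rewrite map_polyX X0 separable_XsubC.
rewrite [red q 'X]map_polyX [X in coprimep _ X]X0 coprimep_XsubC.
rewrite rmorphM rmorphD rmorph1 rmorphXn /= map_polyX map_polyC /root !hornerE.
by rewrite expr0n eqn0Ngt p_gt0 add0r mulr1 intrFp_eq0.
Qed.

Lemma q_maximal_dvd_b4 q :
    squarefreez (b - 4) -> prime q -> q != p ->
    ~~ (q%:Z %| b)%Z -> (q%:Z %| b - 4)%Z ->
  q_maximal t q.
Proof.
move=> sqf_b4 q_pr q_neq_p qb qb4.
have [k Dk qk] := squarefreez_prime sqf_b4 q_pr qb4.
have q_odd : (2 : 'F_q) != 0.
  rewrite (intrFp_eq0 2 q_pr); apply: contra qb => q2.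
  by rewrite -[b](subrK 4) rpredD // -[4]/(2 * 2 : int) dvdz_mull.
have p_neq0 : (p%:R : 'F_q) != 0.
  rewrite pmulrn intrFp_eq0 // dvdzE /= dvdn_prime2 //.
(* With b = 4 + q k, G = h^2 + q F for h = X^p + 2 and F = k (X^p + 1). Separability of h follows
   from X h' - p h = -2p, coprimality from k h - F = k. *)
apply: (@dedekind_q_maximal (G p b) ('X^p + 2%:P) (k%:P * ('X^p + 1)) 2 t q) => //.
- have -> : b = 4 + q%:Z * k by rewrite -Dk; ring.
  by rewrite GE polyCD polyCM; ring.
- rewrite rmorphD rmorphXn /= map_polyX map_polyC /= unlock.
  rewrite derivD derivXn derivC addr0 -[X in coprimep _ X]mulr_natl.
  apply: (@coprimep_const _ (- p%:R) 'X _ _ (- (p%:R * 2))).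
    by rewrite oppr_eq0 mulf_neq0.
  have -> : 'X * (p%:R * 'X^(p.-1)) = p%:R * 'X^p :> {poly 'F_q}.
    by rewrite mulrCA -exprS prednK.
  rewrite rmorphN rmorphM !rmorph_nat; ring.
rewrite rmorphM !rmorphD rmorph1 !rmorphXn /= !map_polyX !map_polyC /=.
apply: (@coprimep_const _ (-1) (k%:~R)%:P _ _ (k%:~R)).
  by rewrite intrFp_eq0.
rewrite ?rmorph_nat ?rmorph_int; ring.
Qed.

(** Frobenius gives G = (X + 2)^(2p) modulo p. The cofactor F is not explicit, so its value at -2 is
    read off from G(-2): it is -k modulo p, where b = 4 + p k. *)
Lemma q_maximal_p_dvd_b4 :
    squarefreez (b - 4) -> odd p ->
    ~~ (p%:Z %| b)%Z -> (p%:Z %| b - 4)%Z ->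
  q_maximal t p.
Proof.
move=> sqf_b4 p_odd pb pb4.
have [k Dk pk] := squarefreez_prime sqf_b4 p_pr pb4.
have Db : b = 4 + p%:Z * k by rewrite -Dk; ring.
have exp2p : (2%:P : {poly 'F_p}) ^+ p = 2%:P by rewrite -polyC_exp expFp.
have [|F DF] := @red_eq p (G p b) (('X + 2%:P) ^+ (2 * p)) p_pr.
  rewrite red_G mulnC rmorphXn rmorphD /= map_polyX map_polyC exprM.
  rewrite exprDn_pchar ?pnat_pchar_polyFp //.
  rewrite [in RHS]exp2p.
  have -> : b%:~R = 4 :> 'F_p.
    rewrite Db intrD intrM (eqP (_ : p%:~R == 0 :> 'F_p)) ?mul0r ?addr0 //.
    by rewrite intrFp_eq0.
  rewrite !rmorph_nat /=; ring.
apply: (@dedekind_q_maximal (G p b) ('X + 2%:P) F (2 * p) t p) => //.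
- by rewrite muln_gt0.
- rewrite rmorphD /= map_polyX map_polyC -[2%:~R%:P]opprK -polyCN.
  exact: separable_XsubC.
rewrite [red p ('X + _)]rmorphD /= map_polyX map_polyC -[2%:~R%:P]opprK -polyCN.
rewrite coprimep_XsubC.
have -> : - 2%:~R = (-2)%:~R :> 'F_p by [].
rewrite /root horner_map /= intrFp_eq0 //.
have [m Dm] : exists m : int, 2 ^+ p = 2 + p%:Z * m.
  have /dvdzP[m Dm] : (p%:Z %| 2 ^+ p - 2)%Z.
    rewrite -intrFp_eq0 // rmorphB rmorphXn /= subr_eq0.
    by rewrite expFp.
  by exists m; rewrite mulrC -Dm addrC subrK.
have F2 : F.[-2] = p%:Z * (m ^+ 2 - k * m) - k.
  have X20 : ('X + 2%:P : {poly int}).[-2] = 0 by rewrite hornerD hornerX hornerC.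
  have /(congr1 (fun P : {poly int} => P.[-2])) := DF.
  rewrite [X in _ = X]hornerD hornerM horner_exp X20 hornerC GE !hornerE.
  rewrite expr0n muln_eq0 /= eqn0Ngt p_gt0 add0r.
  rewrite exprNn -signr_odd p_odd expr1 mulN1r Dm Db => DF2.
  apply: (@mulfI _ p%:Z); first by rewrite eqz_nat -lt0n.
  by rewrite -DF2; ring.
by rewrite F2 rpredBl ?dvdz_mulr.
Qed.

Lemma q_maximal_unramified q :
    prime q -> q != p -> ~~ (q%:Z %| b)%Z -> ~~ (q%:Z %| b - 4)%Z ->
  q_maximal t q.
Proof.
move=> q_pr q_neq_p qb qb4.
apply: (@squarefree_q_maximal (G p b)) => //.
have p_neq0 : (p%:R : 'F_q) != 0.
  by rewrite pmulrn intrFp_eq0 // dvdzE /= dvdn_prime2.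
have b_neq0 : b%:~R != 0 :> 'F_q by rewrite intrFp_eq0.
have b4_neq0 : b%:~R - 4 != 0 :> 'F_q.
  by rewrite (_ : _ - 4 = (b - 4)%:~R) ?intrFp_eq0 // rmorphB.
rewrite red_G unlock; move: (b%:~R : 'F_q) b_neq0 b4_neq0 => c c0 c40.
have -> : ('X^p ^+ 2 + c%:P * 'X^p + c%:P)^`() =
    (p%:R)%:P * 'X^(p.-1) * (2%:P * 'X^p + c%:P) :> {poly 'F_q}.
  rewrite !derivE -mulr_natl [p%:R%:P]polyCMn [2%:P]polyCMn; ring.
rewrite !coprimepMr; apply/andP; split; last first.
  (* With y = X^p, 4 (y^2 + c y + c) - (2 y + c)^2 = -c (c - 4). *)
  apply: (@coprimep_const _ 4%:P (- (2%:P * 'X^p + c%:P)) _ _ (- (c * (c - 4)))).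
    by rewrite oppr_eq0 mulf_neq0.
  rewrite polyCN polyCM polyCB !rmorph_nat /=; ring.
apply/andP; split.
  by apply: (@coprimep_const _ 0 1 _ _ (p%:R)) => //; rewrite mul0r mul1r add0r.
apply: coprimep_expr.
apply: (@coprimep_const _ 1 (- ('X^(p.-1) * ('X^p + c%:P))) _ _ c) => //.
have -> : 'X^p = 'X * 'X^(p.-1) :> {poly 'F_q} by rewrite -exprS prednK.
ring.
Qed.

End QMaximal.

(** * The prime p *)

(* Modulo hpol, x and -(b + x) are the two roots of y^2 + b y + b. *)
Lemma V_mod_hpol b n :
  exists U, (V b n)%:P = 'X^n + (- (b%:P + 'X)) ^+ n + hpol b * U :> {poly int}.
Proof.
suffices [] : (exists U, (V b n)%:P = 'X^n + (- (b%:P + 'X)) ^+ n + hpol b * U :> {poly int}) /\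
  (exists U, (V b n.+1)%:P =
     'X^(n.+1) + (- (b%:P + 'X)) ^+ n.+1 + hpol b * U :> {poly int}) by [].
elim: n => [|n [[U0 D0] [U1 D1]]].
  split; exists 0; rewrite mulr0 addr0 ?expr0 ?expr1.
    by rewrite /= -[2]/(1 + 1 : int) polyCD.
  by rewrite /= polyCN; ring.
split; first by exists U1.
(* Both y = X and y = -(b + X) satisfy y^2 = h - b y - b for h = [hpol b], so the recurrence leaves
   the error -h y^n for each. *)
exists (- b%:P * (U1 + U0) - 'X^n - (- (b%:P + 'X)) ^+ n).
have -> : V b n.+2 = - b * V b n.+1 - b * V b n by [].
rewrite polyCB !polyCM polyCN D0 D1 /hpol !exprS; ring.
Qed.

(** Modulo [hpol b], the n-th powers of the two roots have sum V_n and product b^n. *)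
Lemma Lucas_mod_hpol b n :
  exists W, 'X^n ^+ 2 - (V b n)%:P * 'X^n + (b ^+ n)%:P = hpol b * W :> {poly int}.
Proof.
have [U ->] := V_mod_hpol b n.
have [W DW] : exists W, (b%:P : {poly int}) ^+ n =
    (- (b%:P + 'X) * 'X) ^+ n + hpol b * W :> {poly int}.
  eexists; apply/eqP; rewrite addrC -subr_eq subrXX.
  have -> : b%:P - - (b%:P + 'X) * 'X = hpol b by rewrite /hpol; ring.
  by [].
by exists (W - U * 'X^n); rewrite polyC_exp DW exprMn; ring.
Qed.

Lemma red_hpol p b : red p (hpol b) = 'X^2 + (b%:~R)%:P * 'X + (b%:~R)%:P.
Proof. by rewrite !(rmorphD, rmorphM, rmorphXn) /= !map_polyX !map_polyC. Qed.

Lemma monic_hpol b : hpol b \is monic.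
Proof.
rewrite /hpol monicE -addrA lead_coefDl ?lead_coefXn // size_polyXn.
rewrite (leq_ltn_trans (size_polyD _ _)) // gtn_max mul_polyC.
rewrite (leq_ltn_trans (size_scale_leq _ _)) ?size_polyX //.
by rewrite (leq_ltn_trans (size_polyC_leq1 _)).
Qed.

Lemma size_hpol b : size (hpol b) = 3%N.
Proof.
rewrite /hpol -addrA size_polyDl size_polyXn //.
rewrite (leq_ltn_trans (size_polyD _ _)) // gtn_max mul_polyC.
rewrite (leq_ltn_trans (size_scale_leq _ _)) ?size_polyX //.
by rewrite (leq_ltn_trans (size_polyC_leq1 _)).
Qed.

Lemma red_hpol_exp p b : prime p -> red p (hpol b) ^+ p = red p (G p b).
Proof.
move=> p_pr; rewrite red_hpol red_G !exprDn_pchar ?pnat_pchar_polyFp //.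
by rewrite [(_%:P * 'X) ^+ p]exprMn -polyC_exp expFp // exprAC.
Qed.

(** For odd p, Frobenius turns X^p + (-(b + X))^p into -b, so modulo p the constant V_p + b is a
    multiple of the monic quadratic [hpol b], hence zero. *)
Lemma V_prime p b : prime p -> odd p -> (p%:Z %| V b p + b)%Z.
Proof.
move=> p_pr p_odd; have [U /(congr1 (map_poly (intr : int -> 'F_p)))] := V_mod_hpol b p.
rewrite rmorphD rmorphM rmorphD !rmorphXn rmorphN rmorphD /= !map_polyX !map_polyC /=.
rewrite exprNn -signr_odd p_odd expr1 mulN1r exprDn_pchar ?pnat_pchar_polyFp //.
rewrite -polyC_exp expFp // => DV.
have Dh : red p U * red p (hpol b) = ((V b p + b)%:~R)%:P.
  by rewrite intrD polyCD DV; ring.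
have mh := monic_map (intr : {rmorphism int -> 'F_p}) (monic_hpol b).
have := monic_multiple_small mh (_ : (size (red p U * red p (hpol b))%R < _)%N).
rewrite Dh size_map_poly_id0 ?(monicP (monic_hpol b)) ?oner_eq0 // size_hpol.
rewrite (leq_ltn_trans (size_polyC_leq1 _)) // => /(_ isT)/eqP.
by rewrite polyC_eq0 intrFp_eq0.
Qed.

Lemma fermat_int p b : prime p -> ~~ (p%:Z %| b)%Z -> (p%:Z %| b ^+ p.-1 - 1)%Z.
Proof.
move=> p_pr pb; rewrite -intrFp_eq0 // rmorphB rmorphXn /= subr_eq0.
rewrite -intrFp_eq0 // in pb; apply/eqP; apply: (mulfI pb).
by rewrite -exprS prednK ?prime_gt0 // expFp // mulr1.
Qed.

(** The trinomial X^(2p) - V_p X^p + b^p is a multiple h W of h = [hpol b], and differs from G by p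
    (v X^p - b c). Since h^p = G modulo p, cancelling h gives W = h^(p-1) modulo p. *)
Lemma G_hpol_expansion p b v c :
    prime p -> (0 < p)%N -> V b p + b = p%:Z * v -> b ^+ p.-1 - 1 = p%:Z * c ->
  exists W, G p b = hpol b ^+ p +
    (p%:Z)%:P * (hpol b * W + v%:P * 'X^p - (b * c)%:P).
Proof.
move=> p_pr p_gt0 Dv Dc.
have Dbp : b ^+ p = b + p%:Z * (b * c).
  by rewrite -[in LHS](prednK p_gt0) exprS -[b ^+ _](subrK 1) Dc; ring.
have [W DW] := Lucas_mod_hpol b p.
have GW : G p b = hpol b * W + (p%:Z)%:P * (v%:P * 'X^p - (b * c)%:P).
  rewrite -DW Dbp GE -[V b p](addrK b) Dv !polyCD !polyCM polyCN; ring.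
have [|W2 DW2] := @red_eq p W (hpol b ^+ p.-1) p_pr.
  have mh := monic_map (intr : {rmorphism int -> 'F_p}) (monic_hpol b).
  apply: (mulfI (monic_neq0 mh)).
  have redW := rmorphD (red p) (hpol b * W) ((p%:Z)%:P * (v%:P * 'X^p - (b * c)%:P)).
  rewrite -GW !(rmorphM (red p)) /= red_q0 // mul0r addr0 -red_hpol_exp // in redW.
  by rewrite rmorphXn /= -exprS prednK.
exists W2; have -> : hpol b ^+ p = hpol b * hpol b ^+ p.-1 by rewrite -exprS prednK.
rewrite GW DW2; ring.
Qed.

(** * The criterion at p when p does not divide b *)

Section PrimeP.

Variables (b v c : int) (p : nat).
Hypotheses (p_pr : prime p) (p_odd : odd p).
Hypothesis pb : ~~ (p%:Z %| b)%Z.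
Hypotheses (Dv : V b p + b = p%:Z * v) (Dc : b ^+ p.-1 - 1 = p%:Z * c).

Let p_gt0 : (0 < p)%N := prime_gt0 p_pr.
(** Equal to 4 (v^2 + b c v + b c^2); b Q is four times the resultant of X^2 + b X + b and v X - b
    c. *)
Let Q : int := (2 * v + b * c) ^+ 2 - (b ^+ 2 - 4 * b) * c ^+ 2.

Lemma Fp_4_neq0 : (4 : 'F_p) != 0.
Proof.
rewrite (intrFp_eq0 4 p_pr) dvdzE (_ : `|4|%N = 2 ^ 2)%N // Euclid_dvdX //= andbT.
by rewrite dvdn_prime2 //; apply: contraTneq p_odd => ->.
Qed.

Lemma q_maximal_p t :
    2 <= b -> squarefreez b -> ev t (G p b) = 0 ->
    ~~ (p%:Z %| b ^+ 2 - 4 * b)%Z -> ~~ (p%:Z %| Q)%Z ->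
  q_maximal t p.
Proof.
move=> b_ge2 sqf_b Gt pD pQ.
have [W DG] := G_hpol_expansion p_pr p_gt0 Dv Dc.
have irrG := irreducible_G p_gt0 b_ge2 sqf_b.
apply: (dedekind_q_maximal (monic_G b p_gt0) irrG Gt p_pr p_gt0 DG).
  rewrite red_hpol unlock.
  have -> : ('X^2 + (b%:~R)%:P * 'X + (b%:~R)%:P)^`() = 2 * 'X + (b%:~R)%:P :> {poly 'F_p}.
    by rewrite !derivE; ring.
  apply: (@coprimep_const _ 4 (- (2 * 'X + (b%:~R)%:P)) _ _ (- (b ^+ 2 - 4 * b)%:~R)).
    by rewrite oppr_eq0 intrFp_eq0.
  rewrite intrB !intrM polyCN polyCB !polyCM ?rmorph_nat; ring.
rewrite rmorphB rmorphD 2!rmorphM /= rmorphXn /= map_polyX !map_polyC /=.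
(* Modulo h only v X^p - b c remains of the cofactor, and Frobenius makes it (v X - b c)^p. *)
rewrite -addrA mulrC coprimep_sym coprimep_addl_mul.
have -> : (v%:~R)%:P * 'X^p - ((b * c)%:~R)%:P =
    ((v%:~R)%:P * 'X - ((b * c)%:~R)%:P) ^+ p :> {poly 'F_p}.
  rewrite exprDn_pchar ?pnat_pchar_polyFp // exprNn -signr_odd p_odd expr1 mulN1r.
  by rewrite exprMn -!polyC_exp !expFp.
apply: coprimep_expr; rewrite red_hpol.
(* Elimination of X: 4 v^2 h - 4 (v X + b v + b c) (v X - b c) = b Q. *)
apply: (@coprimep_const _ (4 * (v%:~R)%:P ^+ 2)
  (- 4 * ((v%:~R)%:P * 'X + (b%:~R)%:P * (v%:~R)%:P + (b%:~R)%:P * (c%:~R)%:P))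
  _ _ (b%:~R * Q%:~R)).
  by rewrite mulf_neq0 ?intrFp_eq0.
rewrite /Q !(rmorphB, rmorphD, rmorphM, rmorphXn) /= !rmorph_int; ring.
Qed.

Lemma not_monogenic_G : (p%:Z %| Q)%Z -> ~ monogenic (G p b).
Proof.
move=> pQ; have [W DG] := G_hpol_expansion p_pr p_gt0 Dv Dc.
have b0 : b%:~R != 0 :> 'F_p by rewrite intrFp_eq0.
have Q0 : Q%:~R = 0 :> 'F_p by apply/eqP; rewrite intrFp_eq0.
have eqQ : Q%:~R =
    (2 * v%:~R + b%:~R * c%:~R) ^+ 2 - (b%:~R ^+ 2 - 4 * b%:~R) * c%:~R ^+ 2 :> 'F_p.
  by rewrite /Q; ring.
have p_ge2 := prime_gt1 p_pr.
have hp : hpol b ^+ p = hpol b ^+ 2 * hpol b ^+ (p - 2) by rewrite -exprD subnKC.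
(* If p divides v, then Q = 4 b c^2 modulo p forces p to divide c, so p (v X^p - b c) is divisible
   by p^2 and the obstruction applies with phi = h. *)
have [pv|pv] := boolP (p%:Z %| v)%Z.
  have v0 : v%:~R = 0 :> 'F_p by apply/eqP; rewrite intrFp_eq0.
  have /dvdzP[c2 Dc2] : (p%:Z %| c)%Z.
    rewrite -intrFp_eq0 //; have /eqP := eqQ; rewrite Q0 v0.
    have -> : (2 * 0 + b%:~R * c%:~R) ^+ 2 - (b%:~R ^+ 2 - 4 * b%:~R) * c%:~R ^+ 2 =
      4 * b%:~R * c%:~R ^+ 2 :> 'F_p by ring.
    by rewrite eq_sym !mulf_eq0 (negPf b0) (negPf Fp_4_neq0) /= orbb.
  have /dvdzP[v2 Dv2] := pv.
  apply: (@dedekind_not_monogenic _ (hpol b) (hpol b ^+ (p - 2))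
     (v2%:P * 'X^p - (b * c2)%:P) W p) => //.
  - exact: monic_hpol.
  - by rewrite monic_exp ?monic_hpol.
  - by rewrite size_hpol.
  - rewrite DG -hp Dc2 Dv2 -[(p ^ 2)%N]/(p * p)%N PoszM !polyCM; ring.
  - rewrite -hp size_G // -[leqLHS]prednK; first by rewrite size_exp size_hpol.
    by rewrite size_poly_gt0 expf_neq0 // monic_neq0 // monic_hpol.
have v0 : v%:~R != 0 :> 'F_p by rewrite intrFp_eq0.
(* Otherwise a = b c / v is a common root of h and v X^p - b c modulo p, whence p^2 divides G(a). *)
have [a Da] := intrFp_surj (b%:~R * c%:~R / v%:~R : 'F_p).
have va : v%:~R * a%:~R = b%:~R * c%:~R :> 'F_p by rewrite Da mulrC divfK.
have pha : (p%:Z %| (hpol b).[a])%Z.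
  rewrite -intrFp_eq0 // !hornerE !(rmorphD, rmorphM, rmorphXn) /=.
  rewrite -(mulrI_eq0 _ (mulfI (_ : 4 * v%:~R ^+ 2 != 0))); last first.
    by rewrite mulf_neq0 ?Fp_4_neq0 ?expf_neq0.
  have -> : 4 * v%:~R ^+ 2 * (a%:~R ^+ 2 + b%:~R * a%:~R + b%:~R) =
     4 * ((v%:~R * a%:~R) ^+ 2 + b%:~R * v%:~R * (v%:~R * a%:~R) +
          b%:~R * v%:~R ^+ 2) :> 'F_p by ring.
  rewrite va; apply/eqP; transitivity (b%:~R * Q%:~R : 'F_p); last by rewrite Q0 mulr0.
  by rewrite eqQ; ring.
have pva : (p%:Z %| v * a ^+ p - b * c)%Z.
  by rewrite -intrFp_eq0 // !(rmorphB, rmorphM, rmorphXn) /= expFp // va subrr.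
apply: (@monogenic_not_at_double_root _ a p p_pr).
  rewrite DG hp; move: (hpol b) pha => h pha.
  rewrite !(hornerD, hornerN, hornerM) !hornerC !horner_exp hornerX.
  have /dvdzP[x Dx] := pha; have /dvdzP[y Dy] := pva.
  move: (h.[a] ^+ (p - 2)) => z; rewrite -[h.[a] * _ + _ - _]addrA Dy Dx.
  apply/dvdzP; exists (x * x * z + x * W.[a] + y).
  by rewrite -[(p ^ 2)%N]/(p * p)%N PoszM; ring.
(* All coefficients of G' = p X^(p-1) (2 X^p + b) are divisible by p. *)
rewrite GE !derivE !hornerE hornerMn horner_exp hornerX; apply/dvdzP.
exists (2 * a ^+ p * a ^+ p.-1 + b * a ^+ p.-1).
by rewrite -[a ^+ p.-1 *+ p]mulr_natr natz; ring.
Qed.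

End PrimeP.

(** * The three values of the Legendre symbol *)

(** As [legendre] only tests residues below p, y is replaced by its remainder modulo p. *)
Lemma legendre_nonresidue (a : int) p (y : int) :
  prime p -> legendre a p = -1 -> ~~ (p%:Z %| y ^+ 2 - a)%Z.
Proof.
move=> p_pr; rewrite /legendre; case: ifP => // _; case: existsP => // nex _.
apply/negP=> y2; case: nex.
have p0 : p%:Z != 0 by rewrite eqz_nat -lt0n prime_gt0.
have lt_r : (`|(y %% p%:Z)%Z|%N < p)%N.
  by rewrite -ltz_nat gez0_abs ?modz_ge0 // ltz_pmod // ltz_nat prime_gt0.
exists (Ordinal lt_r) => /=; rewrite gez0_abs ?modz_ge0 // eqz_mod_dvd.
have -> : (y %% p%:Z)%Z ^+ 2 - a =
    (y ^+ 2 - a) - (2 * y - (y %/ p%:Z)%Z * p%:Z) * (y %/ p%:Z)%Z * p%:Z.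
  by rewrite {2 3}(divz_eq y p%:Z); ring.
by rewrite rpredB // dvdz_mull.
Qed.

(** Only the case of p not dividing b (b - 4) is left to a hypothesis; there the answer depends on
    V_p and b^(p-1). *)
Lemma monogenic_G p (b : int) :
    2 <= b -> squarefreez b -> squarefreez (b - 4) -> prime p -> odd p ->
    (forall t, ev t (G p b) = 0 -> ~~ (p%:Z %| b)%Z ->
      ~~ (p%:Z %| b - 4)%Z -> q_maximal t p) ->
  monogenic (G p b).
Proof.
move=> b_ge2 sqf_b sqf_b4 p_pr p_odd max_p; have p_gt0 := prime_gt0 p_pr.
apply: monogenic_of_q_maximal => [|||t q Gt q_pr].
- exact: monic_G.
- by rewrite size_G //; have := prime_gt1 p_pr; lia.
- exact: irreducible_G.
have [qb|qb] := boolP (q%:Z %| b)%Z; first exact: (q_maximal_dvd_b b_ge2 sqf_b p_pr Gt).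
have [qp|q_neq_p] := eqVneq q p.
  subst q; have [pb4|pb4] := boolP (p%:Z %| b - 4)%Z; last exact: max_p.
  exact: (q_maximal_p_dvd_b4 b_ge2 sqf_b p_pr Gt).
have [qb4|qb4] := boolP (q%:Z %| b - 4)%Z.
  exact: (q_maximal_dvd_b4 b_ge2 sqf_b p_pr Gt).
exact: (q_maximal_unramified b_ge2 sqf_b p_pr Gt).
Qed.

Theorem theorem1p5 (b : int) (p : nat)
    (hb : 2 <= b) (sqf_b : squarefreez b) (sqf_b4 : squarefreez (b - 4))
    (p_ge3 : (3 <= p)%N) (p_prime : prime p) :
  let D : int := b ^+ 2 - 4 * b in
  let delta : int := legendre D p in
  [/\ delta = 0 -> monogenic (G p b),
      delta = 1 ->
        (~ monogenic (G p b) <->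
         ((2 * V b p + b ^+ p + b) ^+ 2 - D * (b ^+ p.-1 - 1) ^+ 2
            = 0 %[mod p%:Z ^+ 3])%Z)
    & delta = -1 ->
        (~ monogenic (G p b) <->
         (V b p = - b %[mod p%:Z ^+ 2])%Z
         /\ (b ^+ p.-1 = 1 %[mod p%:Z ^+ 2])%Z)].
Proof.
move=> D delta; have p_odd : odd p.
  by case: (even_prime p_prime) => // p2; rewrite p2 in p_ge3.
have p_gt0 := prime_gt0 p_prime.
have p0 : p%:Z != 0 by rewrite eqz_nat -lt0n.
have DE : D = b * (b - 4) by rewrite /D; ring.
pose Q v c : int := (2 * v + b * c) ^+ 2 - D * c ^+ 2.
have crit : ~~ (p%:Z %| D)%Z -> exists v c,
    [/\ V b p + b = p%:Z * v, b ^+ p.-1 - 1 = p%:Z * c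
      & ~ monogenic (G p b) <-> (p%:Z %| Q v c)%Z].
  move=> pD; have pb : ~~ (p%:Z %| b)%Z.
    by apply: contra pD => pb; rewrite DE dvdz_mulr.
  have /dvdzP[v Dv] := V_prime b p_prime p_odd.
  have /dvdzP[c Dc] := fermat_int p_prime pb.
  rewrite mulrC in Dv; rewrite mulrC in Dc; exists v, c; split=> //; split.
    move=> nmono; apply: contraT => pQ; case: nmono.
    apply: monogenic_G => // t Gt _ _.
    exact: (q_maximal_p p_prime p_odd pb Dv Dc hb sqf_b Gt pD pQ).
  exact: (not_monogenic_G p_prime p_odd pb Dv Dc).
split.
- rewrite /delta /legendre; case: ifP => [pD _|_]; last by case: ifP.
  (* Since p divides D = b (b - 4), the case left open at p is vacuous. *)
  apply: monogenic_G => // t _ pb pb4; move: pD.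
  have pr1 : prime `|p%:Z| by [].
  by rewrite DE dvdzE abszM Euclid_dvdM // -!dvdzE (negPf pb) (negPf pb4).
- move=> d1; have pD : ~~ (p%:Z %| D)%Z.
    by move: d1; rewrite /delta /legendre; case: ifP.
  have [v [c [Dv Dc ->]]] := crit pD.
  have -> : (2 * V b p + b ^+ p + b) ^+ 2 - D * (b ^+ p.-1 - 1) ^+ 2 = p%:Z ^+ 2 * Q v c.
    have bp : b ^+ p = b + p%:Z * (b * c).
      by rewrite -[in LHS](prednK p_gt0) exprS -[b ^+ _](subrK 1) Dc; ring.
    by rewrite Dc bp -[V b p](addrK b) Dv /Q; ring.
  rewrite -(dvdz_mul2l (p := p%:Z ^+ 2)) ?expf_neq0 // -exprSr.
  by rewrite -[X in (_ %| X)%Z]subr0 -eqz_mod_dvd; split=> /eqP.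
move=> dm1; have pD : ~~ (p%:Z %| D)%Z.
  by move: dm1; rewrite /delta /legendre; case: ifP.
have [v [c [Dv Dc ->]]] := crit pD.
have p2 (x y z : int) : x - y = p%:Z * z -> (x = y %[mod p%:Z ^+ 2])%Z <-> (p%:Z %| z)%Z.
  move=> Dxy; rewrite -(dvdz_mul2l (p := p%:Z)) // -expr2 -Dxy -eqz_mod_dvd.
  by split=> /eqP.
rewrite (p2 _ _ v) ?opprK // (p2 _ _ c Dc).
split=> [pQ | [pv pc]]; last first.
  by apply: rpredB; rewrite expr2 !dvdz_mull // rpredD ?dvdz_mull.
(* If p did not divide c, D would be the square of (2 v + b c) / c modulo p. *)
have pc : (p%:Z %| c)%Z.
  apply: contraT; rewrite -intrFp_eq0 // => c0.
  have [y Dy] := intrFp_surj ((2 * v + b * c)%:~R / c%:~R : 'F_p).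
  have := legendre_nonresidue y p_prime dm1.
  rewrite -intrFp_eq0 // rmorphB rmorphXn /= Dy => /negP[].
  rewrite subr_eq0 expr_div_n; apply/eqP/(mulIf (expf_neq0 2 c0)).
  rewrite divfK ?expf_neq0 //; apply/eqP; rewrite -subr_eq0 -!rmorphXn -rmorphM -rmorphB.
  by rewrite intrFp_eq0.
(* With p dividing c, Q = 4 v^2 modulo p. *)
split=> //; have : (p%:Z %| 4 * v * v)%Z.
  have -> : 4 * v * v = Q v c - c * (4 * v * b + b ^+ 2 * c - D * c) by rewrite /Q; ring.
  by rewrite rpredB ?dvdz_mulr.
rewrite -!intrFp_eq0 // !rmorphM /= !mulf_eq0.
by rewrite (negPf (_ : 4%:~R != 0)) ?(Fp_4_neq0 p_prime p_odd) //= orbb.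
Qed.
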